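(* Let $r\ge 1$, $n\ge 0$, $k\ge 0$ be integers and let $\Theta\in(\mathbb{Y}^r)_n$. The insertion-deletion map $\widetilde{\phi}_{r,n}^k$ defined in the context is a bijection $$\widetilde{\phi}_{r,n}^k:\ \mathcal{E}(\Theta)\times([n+1]\times[r])^k\longrightarrow\bigsqcup_{\Lambda\in(\mathbb{Y}^r)_n}\mathcal{E}(\Lambda)\times\mathcal{VT}^{\uparrow}_k(\Theta\rightarrow\Lambda).$$ Moreover, if $k\ge 1$, the map sending $(\Gamma_0,\boldsymbol{i})$ to $(\Gamma_{k-\frac12},\Delta')$, where the same construction is stopped at $\Gamma_{k-\frac12}$ and $\Delta'$ is the sequence of shapes of $(\Gamma_0,\Gamma_{\frac12},\Gamma_1,\dots,\Gamma_{k-\frac12})$, is a bijection $$\mathcal{E}(\Theta)\times([n+1]\times[r])^k\longrightarrow\bigsqcup_{\Lambda\in(\mathbb{Y}^r)_{n+1}}\mathcal{E}(\Lambda)\times\mathcal{VT}^{\uparrow}_{k-\frac12}(\Theta\rightarrow\Lambda).$$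
   Context: $[n]=\{1,\dots,n\}$. $\mathbb{Y}$ is Young's lattice: all integer partitions (identified with Young diagrams) ordered by inclusion. $\mathbb{Y}^r$ is the set of $r$-tuples $\Lambda=(\lambda^{(1)},\dots,\lambda^{(r)})$ of partitions ordered componentwise by inclusion; its minimum is $(\emptyset,\dots,\emptyset)$, the rank of $\Lambda$ is $|\lambda^{(1)}|+\cdots+|\lambda^{(r)}|$, and $(\mathbb{Y}^r)_n$ is the set of elements of rank $n$. $\Lambda$ covers $\Theta$ iff $\Lambda$ is obtained from $\Theta$ by adding one square to exactly one component. A partial tableau is a filling of a Young diagram with distinct integers, increasing along rows and columns. For $\Lambda\in(\mathbb{Y}^r)_n$, $\mathcal{E}(\Lambda)$ is the set of $r$-tuples $(T^{(1)},\dots,T^{(r)})$ of partial tableaux with $T^{(i)}$ of shape $\lambda^{(i)}$ and such that the set of all entries of $T^{(1)},\dots,T^{(r)}$ is exactly $[n]$ (each of these entries occurs once); such tuples encode the saturated chains from $\hat 0$ to $\Lambda$. $\mathcal{VT}^{\uparrow}_k(\Theta\rightarrow\Lambda)$ is the set of sequences $\Theta=\Lambda_0\subseteq\Lambda_{1/2}\supseteq\Lambda_1\subseteq\cdots\subseteq\Lambda_{k-1/2}\supseteq\Lambda_k=\Lambda$ in $\mathbb{Y}^r$ in which consecutive elements differ by a covering relation (alternating up and down steps, $2k$ steps in total). $\mathcal{VT}^{\uparrow}_{k-\frac12}(\Theta\rightarrow\Lambda)$, for $k\ge1$, is the set of such sequences ending after $2k-1$ steps, $\Theta=\Lambda_0\subseteq\Lambda_{1/2}\supseteq\Lambda_1\subseteq\cdots\supseteq\Lambda_{k-1}\subseteq\Lambda_{k-1/2}=\Lambda$.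 Definition of $\widetilde{\phi}_{r,n}^k$. An element $(i,c)\in[n+1]\times[r]$ is viewed as the integer $i$ with color $c$. Given $\Gamma_0\in\mathcal{E}(\Theta)$ and a sequence $\boldsymbol{i}=(i_1,\dots,i_k)$ of colored integers, where $i_j$ has value in $[n+1]$ and color $c(i_j)\in[r]$, define $r$-tuples of partial tableaux iteratively for $j=1,\dots,k$: (1) $\Gamma_{j-\frac12}$ is obtained from $\Gamma_{j-1}$ by first adding $1$ to every entry $i$ of the tableaux of $\Gamma_{j-1}$ with $i\ge i_j$, and then inserting $i_j$ into the $t$-th tableau, $t=c(i_j)$, by RSK row insertion; (2) $\Gamma_j$ is obtained from $\Gamma_{j-\frac12}$ by removing the square containing $n+1$. Then $\widetilde{\phi}_{r,n}^k(\Gamma_0,\boldsymbol{i})=(\Gamma_k,\Delta)$, where $\Delta$ is the sequence of shapes ($r$-tuples of partitions) of $(\Gamma_0,\Gamma_{\frac12},\Gamma_1,\dots,\Gamma_k)$. *)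

(* Defs.v *)
From mathcomp Require Import all_boot.
From mathcomp Require Import boolp classical_sets functions.

Set Implicit Arguments.
Unset Strict Implicit.
Unset Printing Implicit Defensive.

Local Open Scope classical_set_scope.

(* A partition is the weakly decreasing sequence of its nonzero parts, so that
   equality of sequences is equality of partitions. *)
Definition is_part (s : seq nat) : bool := sorted geq s && (0 \notin s).

Definition Yr (r : nat) : set (r.-tuple (seq nat)) :=
  [set L | forall c, is_part (tnth L c)].
Arguments Yr : clear implicits.

Definition rk (r : nat) (L : r.-tuple (seq nat)) : nat :=
  \sum_(c < r) sumn (tnth L c).

Definition Yr_rk (r n : nat) : set (r.-tuple (seq nat)) :=
  Yr r `&` [set L | rk L = n].
Arguments Yr_rk : clear implicits.

(* L is obtained from M by adding a square at the end of row i (counted from 0)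
   of component c.  Only meaningful for L and M in Yr r: this excludes the
   values of i for which the result is not a Young diagram. *)
Definition covers (r : nat) (L M : r.-tuple (seq nat)) : Prop :=
  exists (c : 'I_r) (i : nat),
    tnth L c = incr_nth (tnth M c) i /\
    forall c', c' != c -> tnth L c' = tnth M c'.

(* Sequences M = D_0, D_(1/2), D_1, ... with m steps, alternately up and down,
   starting with an up step.  The element D_(j/2) has index j in the sequence,
   so k full rounds correspond to m = 2k, and k - 1/2 rounds to m = 2k - 1. *)
Definition VTup (r m : nat) (M L : r.-tuple (seq nat)) :
    set (seq (r.-tuple (seq nat))) :=
  [set D | [/\ size D = m.+1,
               nth M D 0 = M /\ nth M D m = L,
               forall j, j <= m -> Yr r (nth M D j)
             & forall j, j < m ->
                 if odd j then covers (nth M D j) (nth M D j.+1)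
                 else covers (nth M D j.+1) (nth M D j)]].

(* A filling of a Young diagram is the sequence of its rows, top row first
   (English convention). *)
Definition tab_shape (T : seq (seq nat)) : seq nat := map size T.

Definition is_ptab (T : seq (seq nat)) : bool :=
  [&& is_part (tab_shape T),
      all (sorted ltn) T,
      sorted (fun u v => all (fun j => nth 0 u j < nth 0 v j) (iota 0 (size v))) T
    & uniq (flatten T)].

Definition shapes (r : nat) (G : r.-tuple (seq (seq nat))) :
    r.-tuple (seq nat) := map_tuple tab_shape G.

Definition entries (r : nat) (G : r.-tuple (seq (seq nat))) : seq nat :=
  flatten [seq flatten T | T <- G].

Definition EE (r : nat) (L : r.-tuple (seq nat)) :
    set (r.-tuple (seq (seq nat))) :=
  [set G | [/\ forall c, is_ptab (tnth G c),
               shapes G = L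
             & perm_eq (entries G) (iota 1 (rk L))]].

(* Inserts x into a row, returning the new row and the bumped entry, if any. *)
Fixpoint row_insert (x : nat) (s : seq nat) : seq nat * option nat :=
  match s with
  | [::] => ([:: x], None)
  | y :: s' => if x < y then (x :: s', Some y)
               else let: (s'', b) := row_insert x s' in (y :: s'', b)
  end.

Fixpoint rsk_insert (x : nat) (T : seq (seq nat)) : seq (seq nat) :=
  match T with
  | [::] => [:: [:: x]]
  | s :: T' =>
      match row_insert x s with
      | (s', None) => s' :: T'
      | (s', Some y) => s' :: rsk_insert y T'
      end
  end.

Definition shift_tab (x : nat) (T : seq (seq nat)) : seq (seq nat) :=
  [seq [seq (if x <= e then e.+1 else e) | e <- s] | s <- T].

(* A row that becomes empty is dropped, as shapes have no zero parts. *)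
Definition remove_entry (m : nat) (T : seq (seq nat)) : seq (seq nat) :=
  [seq s <- [seq [seq e <- s | e != m] | s <- T] | s != [::]].

Definition insert_step (r : nat) (G : r.-tuple (seq (seq nat)))
    (a : nat * 'I_r) : r.-tuple (seq (seq nat)) :=
  [tuple (let T := shift_tab a.1 (tnth G c) in
          if c == a.2 then rsk_insert a.1 T else T) | c < r].

Definition delete_step (r n : nat) (G : r.-tuple (seq (seq nat))) :
    r.-tuple (seq (seq nat)) := map_tuple (remove_entry n.+1) G.

(* The sequence G_0, G_(1/2), G_1, ..., G_k. *)
Fixpoint ins_del (r n : nat) (G : r.-tuple (seq (seq nat)))
    (w : seq (nat * 'I_r)) : seq (r.-tuple (seq (seq nat))) :=
  match w with
  | [::] => [:: G]
  | a :: w' => let H := insert_step G a in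
               [:: G, H & ins_del n (delete_step n H) w']
  end.

Definition words (r n k : nat) : set (k.-tuple (nat * 'I_r)) :=
  [set w | forall j, 1 <= (tnth w j).1 <= n.+1].
Arguments words : clear implicits.

Definition phi (r n k : nat)
    (x : r.-tuple (seq (seq nat)) * k.-tuple (nat * 'I_r)) :
    r.-tuple (seq (seq nat)) * seq (r.-tuple (seq nat)) :=
  let t := ins_del n x.1 x.2 in (last x.1 t, map (@shapes r) t).

(* Keeping the first 2k terms G_0, ..., G_(k-1/2) drops the last deletion. *)
Definition phi_half (r n k : nat)
    (x : r.-tuple (seq (seq nat)) * k.-tuple (nat * 'I_r)) :
    r.-tuple (seq (seq nat)) * seq (r.-tuple (seq nat)) :=
  let t := take (2 * k) (ins_del n x.1 x.2) in (last x.1 t, map (@shapes r) t).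

(* The unions over L of the sets EE L `*` VTup m M L are disjoint. *)
Lemma trivIset_EE_VTup (r m : nat) (M : r.-tuple (seq nat))
    (D : set (r.-tuple (seq nat))) :
  trivIset D (fun L => EE L `*` VTup m M L).
Proof.
by move=> L L' _ _ [[G S]] [[[_ /= <- _] _] [[_ /= <- _] _]].
Qed.

(* Main.v *)
Require Import Defs.
From mathcomp Require Import all_boot.
From mathcomp Require Import boolp classical_sets functions.

Local Open Scope classical_set_scope.

(** Each half-step is invertible once the shapes before and after it are known.

    An up step shifts the labels to make room for [x] and row-inserts [x] into
    one component.  The two shapes differ in a single square, which tells the
    component and the square where the bumping path ended; reverse bumping from
    that square recovers [x] and the tableau, and then the shift can be undone.
    Conversely reverse bumping can start from any square whose removal leaves a
    Young diagram.  A down step erases the largest entry [n.+1], which occupies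
    a corner; the two shapes tell which corner, so that it can be put back, and
    conversely [n.+1] may be added at any corner.  These facts are
    [insert_step_standard], [insert_step_inj], [insert_step_surj], and
    [delete_step_standard], [delete_step_inj], [delete_step_surj].

    A run of [m] half-steps is then treated by induction on [m], peeling off
    the last half-step ([run_bij]).  Both bijections of the theorem are
    instances of this, for [m] equal to twice [k] and to one less.

    No reverse bumping function is introduced: as tableaux are lists of rows
    and rows are lists, injectivity and surjectivity of insertion follow by
    structural induction, first on a row, then on the list of rows.  What makes
    these inductions go through is the relation [above] between consecutive
    rows, which combines the column condition with the comparison of lengths
    and is itself defined by recursion on the two rows. *)

(** * Tableaux by recursion on rows *)

(** Row [u] can stand directly above row [v] in a tableau: every entry of [v]
    has a smaller entry over it, so in particular [v] is not longer than [u]. *)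
Fixpoint above (u v : seq nat) : bool :=
  match u, v with
  | _, [::] => true
  | [::], _ :: _ => false
  | a :: u', b :: v' => (a < b) && above u' v'
  end.

Lemma aboves0 u : above u [::].
Proof. by case: u. Qed.

Lemma aboveE u v : above u v =
  (size v <= size u) && all (fun j => nth 0 u j < nth 0 v j) (iota 0 (size v)).
Proof.
elim: u v => [|a u IHu] [|b v] //=.
rewrite IHu ltnS (iotaDl 1 0) all_map /=.
by case: (a < b); rewrite ?andbF.
Qed.

(** The conditions of [is_ptab] other than distinctness.  As every row is
    [above] the empty row, the default of [head] makes the last row no special
    case. *)
Fixpoint tab (T : seq (seq nat)) : bool :=
  match T with
  | [::] => true
  | s :: T' =>
      [&& s != [::], sorted ltn s, above s (head [::] T') & tab T']
  end.

Lemma is_ptabE T : is_ptab T = tab T && uniq (flatten T).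
Proof.
rewrite /is_ptab !andbA; congr (_ && _).
rewrite /is_part /tab_shape -!andbA.
elim: T => //= s T <-.
rewrite in_cons negb_or eq_sym size_eq0.
case: T => [|t T] /=; first by rewrite aboves0 !andbT.
rewrite aboveE.
case: (s != [::]); rewrite ?andbF //=.
case: (sorted ltn s); rewrite ?andbF //=.
case: (size t <= size s); rewrite ?andbF //=.
by rewrite [RHS]andbCA; congr (_ && _); rewrite [RHS]andbCA; congr (_ && _);
   rewrite [RHS]andbCA.
Qed.

Lemma tab_shape_part T : tab T -> is_part (tab_shape T).
Proof.
rewrite /is_part /tab_shape; elim: T => //= s T IH /and4P[s0 _ sT /IH/andP[p z]].
rewrite in_cons negb_or eq_sym size_eq0 s0 z andbT.
by case: T p sT {IH z} => //= t T ->; rewrite aboveE => /andP[->].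
Qed.

Lemma is_part_cons m sh :
  is_part (m :: sh) = [&& head 0 sh <= m, m != 0 & is_part sh].
Proof.
rewrite /is_part /= in_cons negb_or eq_sym.
by case: sh => [|p sh] /=; rewrite ?andbT // -!andbA; do !bool_congr.
Qed.

(** * Insertion into a row *)

Lemma row_insert_None x s s' : row_insert x s = (s', None) -> s' = rcons s x.
Proof.
elim: s s' => [|a s IHs] s' /=; first by case.
case: ifP => // _; case E: (row_insert x s) => [u b] [<- eb].
by rewrite (IHs u) // E eb.
Qed.

Lemma row_insert_last x s :
  sorted ltn (rcons s x) -> row_insert x s = (rcons s x, None).
Proof.
elim: s => //= a s IHs p; have := order_path_min ltn_trans p.
rewrite all_rcons => /andP[ax _]; rewrite ltnNge (ltnW ax) /=.
by rewrite IHs // (path_sorted p).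
Qed.

Lemma row_insert_Some x s s' y : row_insert x s = (s', Some y) ->
  [/\ x < y, y \in s, size s' = size s & perm_eq (y :: s') (x :: s)].
Proof.
elim: s s' => [|a s IHs] s' //=.
case: ifP => [xa [<- <-]|_].
  by split; rewrite ?mem_head //; apply/permP => p /=; rewrite addnCA.
case E: (row_insert x s) => [u b] [<- eb]; have [|xy ys su pu] := IHs u.
  by rewrite E eb.
split=> //=; rewrite ?in_cons ?ys ?orbT ?su //.
by apply/permP => p; have /permP/(_ p) /= := pu; move=> e; rewrite addnCA e addnCA.
Qed.

(** Strictness is where [x] must differ from the entries of the row. *)
Lemma row_insert_sorted x s :
  sorted ltn s -> x \notin s -> sorted ltn (row_insert x s).1.
Proof.
elim: s => [|a s IHs] //= p; rewrite in_cons negb_or neq_ltn => /andP[xa xs].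
case: ltnP xa => [xa _|_ /= ax].
  by case: s p {IHs xs} => //= b s /andP[ab ->]; rewrite (ltn_trans xa ab).
have := IHs (path_sorted p) xs.
case: s p {IHs xs} => [|b s] /=; first by rewrite ax.
by case: ifP => _ /andP[ab _]; [|case: (row_insert x s) => u c]; rewrite /= ?ax ?ab.
Qed.

(** Insertion only decreases entries and may lengthen the row. *)
(** The bumped entry [y] lands in the next row weakly to the left of the place
    it came from, since the entry below that place, if any, exceeds [y]; hence what
    stands over it afterwards is smaller than [y]. *)
Lemma above_row_insert_l x s t : above s t -> above (row_insert x s).1 t.
Proof.
elim: s t => [|a s IHs] [|b t] //=; first by rewrite aboves0.
case/andP=> ab st; case: ltnP => [xa|_] /=; first by rewrite (ltn_trans xa ab).
by move: (IHs t st); case: (row_insert x s) => u c /= ->; rewrite ab.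
Qed.

(** The bumped entry [y] lands in the next row weakly to the left of the place
    it came from, since the entry below that place, if any, exceeds [y]; hence what
    stands over it afterwards is smaller than [y]. *)
Lemma above_row_insert x s s' y t : row_insert x s = (s', Some y) ->
  above s t -> above s' (row_insert y t).1.
Proof.
elim: s s' t => [|a s IHs] s' t //=.
case: ltnP => [xa [<- <-]|ax].
  case: t => [|b t] /=; first by rewrite xa aboves0.
  by case/andP=> -> st /=; rewrite xa st.
case E: (row_insert x s) => [u c] [<- ec]; rewrite {}ec in E.
have [xy ys _ _] := row_insert_Some _ _ _ _ E.
case: t => [|b t] /=; first by rewrite (leq_ltn_trans ax xy) aboves0.
case/andP=> ab st; case: ltnP => /= _.
  rewrite (leq_ltn_trans ax xy).
  by have := above_row_insert_l x s t st; rewrite E.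
by have := IHs u t E st; case: (row_insert y t) => v d /= ->; rewrite ab.
Qed.

(** [x] sits in [s'] where [y] was, and this place is determined: it is that of
    the last entry smaller than [y].  In the induction the only conflict is that
    one insertion bumps the first entry and the other one does not, which the
    claim [bump] excludes: then [z2], inserted further right, is an entry of
    [u1], so it exceeds [a1], while it must be smaller than the entry [a1] that
    it bumps. *)
Lemma row_insert_inj x1 x2 y s1 s2 s' : sorted ltn s1 -> sorted ltn s2 ->
  row_insert x1 s1 = (s', Some y) -> row_insert x2 s2 = (s', Some y) ->
  x1 = x2 /\ s1 = s2.
Proof.
suff bump z1 z2 a1 a2 u1 u2 v : path ltn a1 u1 -> z1 < a1 ->
    row_insert z2 u2 = (v, Some a1) -> z1 :: u1 = a2 :: v -> a2 <= z2 -> False.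
  elim: s1 s2 s' => [|a1 s1 IHs] [|a2 s2] s' //= p1 p2.
  case: ltnP => [xa1 [<- <-]|ax1]; case: ltnP => [xa2|ax2].
  - by case=> -> -> ->.
  - case E: (row_insert x2 s2) => [v c] [e1 e2 e3].
    rewrite {}e3 in E; case: (bump _ _ _ _ _ _ _ p1 xa1 E _ ax2).
    by rewrite e1 e2.
  - case E: (row_insert x1 s1) => [v c] [<- ec [e1 e2 e3]].
    rewrite {}ec -e3 in E; case: (bump _ _ _ _ _ _ _ p2 xa2 E _ ax1).
    by rewrite e1 e2.
  case E1: (row_insert x1 s1) => [v1 c1] [<- ec1]; rewrite {}ec1 in E1.
  case E2: (row_insert x2 s2) => [v2 c2] [-> e3 e4]; rewrite e3 e4 in E2.
  by have [-> ->] := IHs _ _ (path_sorted p1) (path_sorted p2) E1 E2.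
move=> p za E [<- e] az; have [lt_za zu _ pu] := row_insert_Some _ _ _ _ E.
have : z2 \in a1 :: v by rewrite (perm_mem pu) mem_head.
rewrite -e in_cons ltn_eqF //= => zv.
have /allP/(_ _ zv) /= := order_path_min ltn_trans p.
by rewrite ltnNge ltnW.
Qed.

(** Reverse bumping in a row: [y] replaces the last entry of [s'] smaller than
    [y].  There is one because [y] has been inserted into the row below, so that
    an entry of [s'] stands over it; and [s] is above [t] because the
    replaced entry is weakly to the right of the place of [y] in the lower row,
    where the entries of [t] exceed [y]. *)
Lemma row_insert_surj y s' t :
  sorted ltn s' -> sorted ltn t -> y \notin s' ->
  above s' (row_insert y t).1 ->
  exists x s, [/\ row_insert x s = (s', Some y), sorted ltn s & above s t].
Proof.
elim: s' t => [|a s' IHs] t //=.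
  by case: t => //= b t _ _ _; case: ifP => //; case: (row_insert y t).
move=> p st; rewrite in_cons negb_or => /andP[ya ys] ab.
have lt_ay : a < y.
  case: t ab {st} => [|b t] /=; first by case/andP.
  by case: ltnP => [_ /andP[] //|by_]; case: (row_insert y t) => u c /andP[lt_ab _]; exact: leq_trans lt_ab by_.
have [lt_hy | ge_hy] := boolP (head y s' < y).
  have sbt : sorted ltn (behead t) by case: t st {ab} => //= b t /path_sorted.
  have abt : above s' (row_insert y (behead t)).1.
    (* If [y] has landed in the first column, it is smaller than all of [t]
       and lands at the head again once that column is dropped, under an
       entry that is smaller by [lt_hy]. *)
    case: s' lt_hy ab {IHs p ys} => //= [|c s' cy]; first by rewrite ltnn.
    case: t st {sbt} => [|b t] /=; first by rewrite cy !aboves0.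
    case: ltnP => [yb pt /andP[_] /=|_ _].
      case: t pt => [|d t] /=; first by rewrite cy aboves0.
      by case/andP=> bd _; rewrite (ltn_trans yb bd) /= => /andP[_ ->]; rewrite cy.
    by case: (row_insert y t) => u c' /andP[].
  have [x [s [E ss sat]]] := IHs _ (path_sorted p) sbt ys abt.
  have [xy _ _ pu] := row_insert_Some _ _ _ _ E.
  have lt_a z : z \in y :: s' -> a < z.
    rewrite in_cons => /predU1P[-> //|].
    by move/allP: (order_path_min ltn_trans p) => /[apply].
  exists x, (a :: s); split.
  - by rewrite /= E ltnNge ltnW // lt_a // (perm_mem pu) mem_head.
  - rewrite /= path_sortedE ?ss ?andbT; last exact: ltn_trans.
    by apply/allP => z zs; apply: lt_a; rewrite (perm_mem pu) in_cons zs orbT.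
  case: t sat ab {st sbt abt} => [|b t] //= -> ; rewrite andbT.
  case: ltnP => [yb _|_]; first exact: ltn_trans yb.
  by case: (row_insert y t) => u c /andP[].
(* No entry after [a] is smaller than [y], so [a] is the one to replace. *)
exists a, (y :: s'); split.
- by rewrite /= lt_ay.
- case: s' p ys ge_hy {ab IHs} => //= c s' /andP[_ ->].
  by rewrite in_cons negb_or neq_ltn andbT => /andP[/orP[] // lt_cy _] /negP[].
case: t ab {st} => [|b t] //=.
case: ltnP => [yb /andP[_ ->] //|_].
case E: (row_insert y t) => [t' c'] /andP[_] /=.
case: s' ge_hy {p ys IHs} => [|c s'] /=.
  by case: t E => [|d t] /=; [case=> <-|case: ifP => _; [|case: (row_insert y t) => ? ?]; case=> <-].
move=> cy; case: t E => [|d t] /=; first by case=> <- _ /=; rewrite (negPf cy).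
case: ltnP => [_ [<- _] /=|dy]; first by rewrite (negPf cy).
case: (row_insert y t) => u e [<- _] /= /andP[cd _].
by rewrite (leq_trans cd dy) in cy.
Qed.

(** * Insertion into a tableau *)

Lemma head_rsk_insert x T :
  head [::] (rsk_insert x T) = (row_insert x (head [::] T)).1.
Proof. by case: T => //= s T; case: (row_insert x s) => u []. Qed.

Lemma rsk_insert_perm x T : perm_eq (flatten (rsk_insert x T)) (x :: flatten T).
Proof.
elim: T x => //= s T IHT x; case E: (row_insert x s) => [u [y|]] /=.
  have [_ _ _ pu] := row_insert_Some _ _ _ _ E.
  apply/permP => p; have /permP/(_ p) /= ep := pu.
  by rewrite /= !count_cat (permP (IHT y)) /= addnCA addnA ep addnA.
by rewrite (row_insert_None _ _ _ E) cat_rcons -cat_cons -cat1s perm_catCA.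
Qed.

Lemma rsk_insert_tab x T :
  tab T -> uniq (x :: flatten T) -> tab (rsk_insert x T).
Proof.
elim: T x => //= s T IHT x /and4P[s0 ss sT tT].
rewrite mem_cat negb_or cat_uniq -!andbA => /and5P[xs xT us usT uT].
have := row_insert_sorted x s ss xs.
case E: (row_insert x s) => [u [y|]] /= su; last first.
  have := above_row_insert_l x s _ sT; rewrite E su tT /= => ->.
  by rewrite (row_insert_None _ _ _ E); case: (s).
have [_ ys eu _] := row_insert_Some _ _ _ _ E.
rewrite -size_eq0 eu size_eq0 s0 su head_rsk_insert.
rewrite (above_row_insert _ _ _ _ _ E sT) IHT //= uT andbT.
by apply: contra usT => yT; apply/hasP; exists y.
Qed.

Lemma rsk_insert_shape x T :
  exists i, tab_shape (rsk_insert x T) = incr_nth (tab_shape T) i.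
Proof.
rewrite /tab_shape; elim: T x => [|s T IHT] x /=; first by exists 0.
case E: (row_insert x s) => [u [y|]].
  have [i ei] := IHT y; exists i.+1; rewrite /= ei.
  by have [_ _ -> _] := row_insert_Some _ _ _ _ E.
by exists 0; rewrite (row_insert_None _ _ _ E) /= size_rcons.
Qed.

(** The shapes decide in each row whether an entry is bumped, because only an
    insertion that bumps nothing lengthens the row.  The bumped entry is known
    from the rows below by induction, which determines the row. *)
Lemma rsk_insert_inj x1 x2 T1 T2 : tab T1 -> tab T2 ->
  tab_shape T1 = tab_shape T2 -> rsk_insert x1 T1 = rsk_insert x2 T2 ->
  x1 = x2 /\ T1 = T2.
Proof.
elim: T1 x1 x2 T2 => [|s1 T1 IHT] x1 x2 [|s2 T2] //=; first by move=> _ _ _ [->].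
move=> /and4P[_ ss1 _ t1] /and4P[_ ss2 _ t2] [es eT].
case E1: (row_insert x1 s1) => [u1 [y1|]]; case E2: (row_insert x2 s2) => [u2 [y2|]];
  case=> eu.
- move=> e; have [ey ->] := IHT _ _ _ t1 t2 eT e.
  rewrite eu ey in E1.
  by have [-> ->] := row_insert_inj _ _ _ _ _ _ ss1 ss2 E1 E2.
- have [_ _ s_u _] := row_insert_Some _ _ _ _ E1; have e := row_insert_None _ _ _ E2.
  by move: s_u; rewrite eu e size_rcons es => /eqP; rewrite ?(gtn_eqF (ltnSn _)) ?(ltn_eqF (ltnSn _)).
- have [_ _ s_u _] := row_insert_Some _ _ _ _ E2; have e := row_insert_None _ _ _ E1.
  by move: s_u; rewrite -eu e size_rcons es => /eqP; rewrite ?(gtn_eqF (ltnSn _)) ?(ltn_eqF (ltnSn _)).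
move=> ->; move: eu; rewrite (row_insert_None _ _ _ E1) (row_insert_None _ _ _ E2).
by move/rcons_inj => [-> ->].
Qed.

Lemma above_rcons_l s m t : above s t -> above (rcons s m) t.
Proof.
elim: s t => [|a s IHs] [|b t] //= /andP[-> st].
exact: IHs.
Qed.

Lemma above_size s t : above s t -> size t <= size s.
Proof. by rewrite aboveE => /andP[]. Qed.

Lemma above_rcons_l_inv s m t :
  size t <= size s -> above (rcons s m) t -> above s t.
Proof.
by elim: s t => [|a s IHs] [|b t] //= st /andP[-> ]; apply: IHs.
Qed.

Lemma above_rcons_r s m t :
  size t < size s -> all (fun e => e < m) s -> above s t -> above s (rcons t m).
Proof.
elim: s t => [|a s IHs] [|b t] //=; first by move=> _ /andP[-> _]; rewrite aboves0.
by move=> st /andP[_ sm] /andP[-> ]; apply: IHs.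
Qed.

Lemma above_rcons_r_inv s m t : above s (rcons t m) -> above s t.
Proof.
elim: s t => [|a s IHs] [|b t] //= /andP[-> ]; exact: IHs.
Qed.

Lemma tab_head0 T : tab T -> (head [::] T == [::]) = (T == [::]).
Proof. by case: T => //= s T /and4P[/negPf->]. Qed.

Lemma head_shape T : head 0 (tab_shape T) = size (head [::] T).
Proof. by case: T. Qed.

(** Reverse insertion from the square that [incr_nth] adds to row [i]: that
    square ends its row, so its entry can be taken out, and is then moved up
    through the rows above by [row_insert_surj]. *)
Lemma rsk_insert_surj T' sh i : tab T' -> uniq (flatten T') -> is_part sh ->
  tab_shape T' = incr_nth sh i ->
  exists x T, [/\ tab T, tab_shape T = sh & rsk_insert x T = T'].
Proof.
rewrite /tab_shape.
elim: T' sh i => [|s' T' IHT] [|m sh] [|i] //=.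
- case: T' {IHT} => //= /and4P[_ _ _ _] _ _ [].
  by case: s' => // a [|? ?] // _; exists a, [::].
- by case/and4P => s0 _ _ _ _ _ [/eqP]; rewrite size_eq0 (negPf s0).
- move=> /and4P[s0 ss sT tT] _ shp [es eT].
  case/lastP: s' s0 ss sT es => // s x _ ss sT; rewrite size_rcons => -[es].
  exists x, (s :: T'); rewrite /= es eT (row_insert_last _ _ ss).
  rewrite is_part_cons -eT in shp; case/and3P: shp => hm m0 _.
  split=> //; rewrite tT -size_eq0 es m0 /=.
  rewrite (above_rcons_l_inv _ x) // ?es -?head_shape //.
  by case: (s) ss => //= a u; rewrite rcons_path => /andP[->].
move=> /and4P[s0 ss sT tT]; rewrite cat_uniq => /and3P[us usT uT] shp [es eT].
have /and3P[hm m0 shp'] : [&& head 0 sh <= m, m != 0 & is_part sh].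
  by rewrite -is_part_cons.
have [y [T [tT1 eT1 iT1]]] := IHT _ _ tT uT shp' eT.
have ys : y \notin s'.
  apply: contra usT => ys; apply/hasP; exists y => //.
  by rewrite -iT1 (perm_mem (rsk_insert_perm _ _)) mem_head.
rewrite -iT1 head_rsk_insert in sT.
have sh1 : sorted ltn (head [::] T) by case: (T) tT1 => //= t U /and4P[].
have [x [s [E ss1 st]]] := row_insert_surj _ _ _ ss sh1 ys sT.
have [_ _ eu _] := row_insert_Some _ _ _ _ E.
exists x, (s :: T); rewrite /= E iT1 eT1 ss1 st tT1 -es eu.
by split=> //; rewrite -size_eq0 -eu size_eq0 s0.
Qed.

(** * Removing the largest entry *)

(** The new square at the end of row [i]; meaningful for [i] at most the number
    of rows, the last value creating a new row. *)
Fixpoint append_at (m i : nat) (T : seq (seq nat)) {struct T} : seq (seq nat) :=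
  match T, i with
  | [::], _ => [:: [:: m]]
  | s :: T', 0 => rcons s m :: T'
  | s :: T', i'.+1 => s :: append_at m i' T'
  end.

Lemma append_at_perm m i T : perm_eq (flatten (append_at m i T)) (m :: flatten T).
Proof.
elim: T i => [|s T IHT] [|i] //=; first by rewrite cat_rcons -cat_cons -cat1s perm_catCA.
by rewrite perm_sym -cat1s perm_catCA perm_cat2l perm_sym.
Qed.

Lemma filter_notin (m : nat) s : m \notin s -> [seq e <- s | e != m] = s.
Proof.
by move=> ms; apply/all_filterP/allP => e es; apply: contraNneq ms => <-.
Qed.

Lemma remove_entry_id m T : tab T -> m \notin flatten T -> remove_entry m T = T.
Proof.
rewrite /remove_entry.
elim: T => //= s T IHT /and4P[s0 _ _ tT]; rewrite mem_cat negb_or => /andP[ms mT].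
by rewrite filter_notin // s0 IHT.
Qed.

Lemma append_atK m i T :
  tab T -> m \notin flatten T -> remove_entry m (append_at m i T) = T.
Proof.
elim: T i => [|s T IHT] i; first by move=> _ _; rewrite /remove_entry /= eqxx.
move=> tsT; have := tsT; rewrite /= => /and4P[s0 _ _ tT].
rewrite mem_cat negb_or => /andP[ms mT].
case: i => [|i]; rewrite /remove_entry /= ?filter_rcons ?eqxx filter_notin // s0.
  by congr (_ :: _); apply: remove_entry_id.
by congr (_ :: _); apply: IHT.
Qed.

Lemma append_at_tab m i T : tab T -> all (fun e => e < m) (flatten T) ->
  is_part (incr_nth (tab_shape T) i) ->
  tab (append_at m i T) /\ tab_shape (append_at m i T) = incr_nth (tab_shape T) i.
Proof.
rewrite /tab_shape; elim: T i => [|s T IHT] i /=.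
  by case: i => //= i; rewrite is_part_cons andbF.
case/and4P=> s0 ss sT tT; rewrite all_cat => /andP[sm Tm].
case: i => [|i] /=.
  move=> _; rewrite size_rcons tT above_rcons_l //= andbT; split=> //.
  case: s s0 ss sm {sT} => [|a s] //= _ p /andP[am sm].
  by rewrite rcons_path p; case/lastP: s sm {p} => //= s b; rewrite all_rcons last_rcons => /andP[].
rewrite is_part_cons => /and3P[hm _ p]; have [tA eA] := IHT i tT Tm p.
rewrite s0 ss tA eA !andbT; split=> //.
rewrite -eA -/(tab_shape _) head_shape in hm.
case: T sT hm {IHT tT Tm p tA eA} => [|t T] /= sT.
  by case: i => [|i] hm; apply: (above_rcons_r _ _ [::]); rewrite ?aboves0.
by case: i => //= hm; apply: above_rcons_r; rewrite -?(size_rcons t m).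
Qed.

Lemma sorted_max m s : sorted ltn s -> m \in s -> all (fun e => e <= m) s ->
  exists s', s = rcons s' m.
Proof.
elim: s => //= a s IHs p; rewrite in_cons => /predU1P[am|ms] /andP[_ sm].
  exists [::]; rewrite am in sm *.
  case: s p sm {IHs} => //= b s /andP[ab _] /andP[ba _].
  by rewrite leqNgt ab in ba.
by have [s' ->] := IHs (path_sorted p) ms sm; exists (a :: s').
Qed.

(** The largest entry of a tableau ends its row, and nothing stands below it. *)
Lemma tab_max m T : tab T -> uniq (flatten T) -> m \in flatten T ->
  all (fun e => e <= m) (flatten T) ->
  exists i T0, [/\ tab T0, m \notin flatten T0, T = append_at m i T0 &
                   tab_shape T = incr_nth (tab_shape T0) i].
Proof.
rewrite /tab_shape; elim: T => //= s T IHT /and4P[s0 ss sT tT].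
rewrite cat_uniq mem_cat all_cat => /and3P[us usT uT] msT /andP[sm Tm].
have [ms|ms] := boolP (m \in s).
  have mT : m \notin flatten T.
    by apply: contra usT => mT; apply/hasP; exists m.
  have [s1 es] := sorted_max _ _ ss ms sm; subst s.
  have ts1 : size (head [::] T) <= size s1.
    rewrite -ltnS -(size_rcons s1 m) ltn_neqAle above_size // andbT.
    apply/negP => /eqP e; have := sT; rewrite aboveE e size_rcons => /andP[_ /allP/(_ (size s1))].
    rewrite mem_iota ltnSn nth_rcons ltnn eqxx.
    move/(_ isT); apply/negP; rewrite -leqNgt.
    case: T Tm e {IHT sT tT usT uT mT msT} => [|t T] /=; first by rewrite nth_nil.
    rewrite all_cat => /andP[/allP tm _] e; apply: tm.
    by rewrite mem_nth // e size_rcons.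
  have sT1 := above_rcons_l_inv _ _ _ ts1 sT.
  have ss1 : sorted ltn s1 by case: (s1) ss => //= a u; rewrite rcons_path => /andP[].
  have ms1 : m \notin s1 by move: us; rewrite rcons_uniq => /andP[].
  exists 0; case: (eqVneq s1 [::]) => [e|s10].
    have /eqP eT0 : T == [::] by move: ts1; rewrite e leqn0 size_eq0 tab_head0.
    by exists [::]; rewrite eT0 e.
  by exists (s1 :: T); rewrite /= s10 ss1 sT1 tT mem_cat negb_or ms1 mT size_rcons.
have mT : m \in flatten T by move: msT; rewrite (negPf ms).
have [i [T0 [tT0 mT0 eT eS]]] := IHT tT uT mT Tm.
exists i.+1, (s :: T0); rewrite /= mem_cat negb_or ms mT0 tT0 s0 ss eS eT; split=> //.
rewrite eT in sT; rewrite andbT /=.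
case: T0 i sT {tT0 mT0 eT eS} => [|t T0] [|i] //=; rewrite ?aboves0 //.
exact: above_rcons_r_inv.
Qed.

(** * Shifting labels *)

(** Expressed by [bump], the shift comes with the left inverse [unbump]. *)
Lemma shift_tabE x T : shift_tab x T = map (map (bump x)) T.
Proof.
apply: eq_map => s; apply: eq_map => e.
by rewrite /bump; case: leqP.
Qed.

Lemma bump_inj x : injective (bump x).
Proof. exact: can_inj (bumpK x). Qed.

Lemma above_map (f : nat -> nat) s t : {in s & t, {homo f : a b / a < b}} ->
  above s t -> above (map f s) (map f t).
Proof.
elim: s t => [|a s IHs] [|b t] //= fm /andP[ab st].
rewrite fm ?mem_head ?IHs // => d e ds et.
by apply: fm; rewrite in_cons ?ds ?et orbT.
Qed.

Lemma tab_map (f : nat -> nat) T : {in flatten T &, {homo f : a b / a < b}} ->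
  tab T -> tab (map (map f) T).
Proof.
elim: T => //= s T IHT fm /and4P[s0 ss sT tT].
rewrite -size_eq0 size_map size_eq0 s0 /=.
have fs : {in s &, {homo f : a b / a < b}}.
  by move=> a b as_ bs; apply: fm; rewrite mem_cat ?as_ ?bs.
have allss : all (mem s) s by apply/allP.
rewrite (homo_sorted_in fs allss ss) IHT //=.
  rewrite andbT; case: T sT fm {IHT tT} => [|t T] /= sT fm; first by rewrite aboves0.
  apply: above_map sT => a b as_ bs.
  by apply: fm; rewrite !mem_cat ?as_ ?bs ?orbT.
by move=> a b aT bT; apply: fm; rewrite mem_cat ?aT ?bT orbT.
Qed.

Lemma shape_map (f : nat -> nat) T : tab_shape (map (map f) T) = tab_shape T.
Proof. by rewrite /tab_shape -map_comp; apply: eq_map => s; rewrite /= size_map. Qed.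

Lemma ltn_bump x : {homo bump x : a b / a < b}.
Proof. by move=> a b ab; rewrite !ltnNge leq_bump2 -ltnNge. Qed.

Lemma ltn_unbump x : {in predC1 x &, {homo unbump x : a b / a < b}}.
Proof.
move=> a b ax bx ab; rewrite ltnNge -(leq_bump2 x) !unbumpK //.
by rewrite -ltnNge.
Qed.

(** After the shift the labels are those from [1] to [n.+1] other than [x]. *)
Lemma perm_bump_iota n x : 0 < x <= n.+1 ->
  perm_eq (x :: map (bump x) (iota 1 n)) (iota 1 n.+1).
Proof.
move=> xn.
have ux : uniq (x :: map (bump x) (iota 1 n)).
  rewrite cons_uniq (map_inj_uniq (bump_inj x)) iota_uniq andbT.
  by apply/mapP => -[e _]; apply/eqP; exact: neq_bump.
have sub : {subset x :: map (bump x) (iota 1 n) <= iota 1 n.+1}.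
  move=> e; rewrite in_cons mem_iota => /predU1P[->|/mapP[d]]; first by rewrite add1n.
  rewrite mem_iota add1n => /andP[d0 dn] ->; rewrite add1n /bump addn_gt0 d0 orbT /=.
  by rewrite -addnS -[n.+2]add1n leq_add ?leq_b1.
apply: uniq_perm; rewrite ?iota_uniq //.
by have [] := uniq_min_size ux sub _; rewrite /= ?size_map ?size_iota.
Qed.

Lemma perm_iota_last n : perm_eq (n.+1 :: iota 1 n) (iota 1 n.+1).
Proof. have := iotaD 1 n 1; rewrite addn1 add1n cats1 => ->; by rewrite perm_sym perm_rcons. Qed.

(** * Half-steps on tuples of tableaux *)

Section Tuples.

Context {r : nat}.
Implicit Types (G H K : r.-tuple (seq (seq nat))) (L M : r.-tuple (seq nat)).

(** Membership in [EE], with the shape left free.  The shape determines [n]. *)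
Definition standard (n : nat) G : Prop :=
  (forall c, is_ptab (tnth G c)) /\ perm_eq (entries G) (iota 1 n).

Lemma count_entries p G :
  count p (entries G) = \sum_(c < r) count p (flatten (tnth G c)).
Proof.
by rewrite /entries count_flatten sumnE !big_map big_tuple.
Qed.

Lemma mem_entries e G c : e \in flatten (tnth G c) -> e \in entries G.
Proof.
by move=> ec; apply/flattenP; exists (flatten (tnth G c)); rewrite ?map_f ?mem_tnth.
Qed.

Lemma entriesP e G : e \in entries G -> exists c, e \in flatten (tnth G c).
Proof. by case/flattenP => s /mapP[T /tnthP[c ->] ->]; exists c. Qed.

Lemma entries_add x c G H :
  perm_eq (flatten (tnth H c)) (x :: flatten (tnth G c)) ->
  (forall c', c' != c -> tnth H c' = tnth G c') ->
  perm_eq (entries H) (x :: entries G).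
Proof.
move=> /permP hc hc'; apply/permP => p.
rewrite /= !count_entries (bigD1 c) // [in RHS](bigD1 c) //= hc /= addnA.
by congr (_ + _); apply: eq_bigr => c' /hc' ->.
Qed.

Lemma entries_map (f : nat -> nat) G :
  entries (map_tuple (map (map f)) G) = map f (entries G).
Proof.
rewrite /entries map_flatten -!map_comp; congr flatten; apply: eq_map => T /=.
by rewrite map_flatten.
Qed.

Lemma tnth_shapes G c : tnth (shapes G) c = tab_shape (tnth G c).
Proof. exact: tnth_map. Qed.

Lemma size_entries G : size (entries G) = rk (shapes G).
Proof.
rewrite -count_predT count_entries; apply: eq_bigr => c _.
by rewrite tnth_shapes count_predT size_flatten.
Qed.

Lemma standard_rk n G : standard n G -> rk (shapes G) = n.
Proof. by case=> _ /perm_size; rewrite size_iota size_entries. Qed.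

Lemma standard_Yr n G : standard n G -> Yr r (shapes G).
Proof.
case=> tG _ c; rewrite tnth_shapes; apply: tab_shape_part.
by have := tG c; rewrite is_ptabE => /andP[].
Qed.

Lemma standard_tab n G : standard n G -> forall c, tab (tnth G c).
Proof. by case=> tG _ c; have := tG c; rewrite is_ptabE => /andP[]. Qed.

Lemma standard_uniq n G : standard n G -> forall c, uniq (flatten (tnth G c)).
Proof. by case=> tG _ c; have := tG c; rewrite is_ptabE => /andP[]. Qed.

Lemma standard_mem n G e : standard n G -> (e \in entries G) = (0 < e <= n).
Proof. by case=> _ /perm_mem ->; rewrite mem_iota add1n ltnS. Qed.

Lemma EE_standard n L G : rk L = n -> EE L G <-> standard n G /\ shapes G = L.
Proof.
move=> <-; split=> [[tG sG pG]|[[tG pG] sG]]; by split.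
Qed.

Lemma tnth_insert_step G a c : tnth (insert_step G a) c =
  let T := map (map (bump a.1)) (tnth G c) in
  if c == a.2 then rsk_insert a.1 T else T.
Proof. by rewrite tnth_mktuple shift_tabE. Qed.

Lemma insert_step_standard n G a : standard n G -> 0 < a.1 <= n.+1 ->
  standard n.+1 (insert_step G a) /\ covers (shapes (insert_step G a)) (shapes G).
Proof.
case: a => x c /= sG xn; set H := insert_step _ _.
pose K := map_tuple (map (map (bump x))) G.
have KE c' : tnth K c' = map (map (bump x)) (tnth G c') by exact: tnth_map.
have HE c' : tnth H c' = if c' == c then rsk_insert x (tnth K c') else tnth K c'.
  by rewrite tnth_insert_step KE.
have tK c' : tab (tnth K c').
  by rewrite KE; apply: tab_map (standard_tab n G sG c') => i j _ _; apply: ltn_bump.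
have uK c' : uniq (x :: flatten (tnth K c')).
  rewrite KE -map_flatten cons_uniq (map_inj_uniq (bump_inj x)).
  rewrite (standard_uniq n G sG) andbT.
  by apply/mapP => -[e _]; apply/eqP; exact: neq_bump.
split; first split.
- move=> c'; rewrite is_ptabE HE; case: eqP => _.
    rewrite (perm_uniq (rsk_insert_perm _ _)) uK andbT.
    exact: rsk_insert_tab (tK c') (uK c').
  by have := uK c'; rewrite tK cons_uniq => /andP[_ ->].
- have pH : perm_eq (entries H) (x :: entries K).
    apply: (entries_add x c) => [|c' /negPf cc']; rewrite HE ?eqxx ?cc' //.
    exact: rsk_insert_perm.
  rewrite (perm_trans pH) // (perm_trans _ (perm_bump_iota n x xn)) //.
  by rewrite perm_cons entries_map perm_map //; case: sG.
have [i ei] := rsk_insert_shape x (tnth K c).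
exists c, i; split=> [|c' /negPf cc']; rewrite !tnth_shapes HE ?eqxx ?cc' ?ei KE shape_map //.
Qed.

Lemma incr_nth_neq s i : incr_nth s i <> s.
Proof.
move=> /(congr1 (fun t => nth 0 t i)); rewrite nth_incr_nth eqxx add1n.
by move/eqP; rewrite gtn_eqF.
Qed.

(** The color is the component whose shape has grown, so both letters have the
    same one.  There [rsk_insert_inj] gives the inserted label and the shifted
    tableau. *)
Lemma insert_step_inj n1 n2 G1 G2 a1 a2 : standard n1 G1 -> standard n2 G2 ->
  shapes G1 = shapes G2 -> insert_step G1 a1 = insert_step G2 a2 ->
  G1 = G2 /\ a1 = a2.
Proof.
case: a1 a2 => [x1 c1] [x2 c2] s1 s2 eS eH.
have eHc c := congr1 (fun H => tnth H c) eH.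
have eSc c : tab_shape (tnth G1 c) = tab_shape (tnth G2 c).
  by rewrite -!tnth_shapes eS.
have tG1 c : tab (map (map (bump x1)) (tnth G1 c)).
  by apply: tab_map (standard_tab _ _ s1 c) => i j _ _; apply: ltn_bump.
have tG2 c : tab (map (map (bump x2)) (tnth G2 c)).
  by apply: tab_map (standard_tab _ _ s2 c) => i j _ _; apply: ltn_bump.
have ec : c1 = c2.
  apply/eqP/negP => /negP/negPf c12.
  have := congr1 tab_shape (eHc c1); rewrite !tnth_insert_step /= eqxx c12.
  have [i ->] := rsk_insert_shape x1 (map (map (bump x1)) (tnth G1 c1)).
  by rewrite !shape_map eSc; apply: incr_nth_neq.
rewrite -ec in eHc *.
have [ex _] : x1 = x2 /\ map (map (bump x1)) (tnth G1 c1) = map (map (bump x2)) (tnth G2 c1).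
  apply: rsk_insert_inj; rewrite ?shape_map //.
  by have := eHc c1; rewrite !tnth_insert_step /= eqxx.
split; last by rewrite ex.
apply: eq_from_tnth => c; apply: (inj_map (inj_map (bump_inj x1))).
have := eHc c; rewrite !tnth_insert_step /= -ex; case: eqP => // _ e.
rewrite -ex in tG2.
by have [] := rsk_insert_inj _ _ _ _ (tG1 c) (tG2 c) _ e; rewrite ?shape_map ?eSc.
Qed.

(** Reverse insertion in the component of the added square yields a label [x]
    absent from the remaining tableaux [K], so the shift by [x] can be undone. *)
Lemma insert_step_surj n H L : standard n.+1 H -> Yr r L -> covers (shapes H) L ->
  exists G a, [/\ standard n G, shapes G = L, 0 < a.1 <= n.+1 & insert_step G a = H].
Proof.
move=> sH yL [c [i [ei eo]]]; rewrite tnth_shapes in ei.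
have [x [T [tT eT iT]]] :=
  rsk_insert_surj _ _ _ (standard_tab _ _ sH c) (standard_uniq _ _ sH c) (yL c) ei.
pose K := [tuple (if c' == c then T else tnth H c') | c' < r].
have KE c' : tnth K c' = if c' == c then T else tnth H c' by rewrite tnth_mktuple.
have pK : perm_eq (entries H) (x :: entries K).
  apply: (entries_add x c) => [|c' /negPf cc']; rewrite KE ?eqxx ?cc' // -iT.
  exact: rsk_insert_perm.
have xH : 0 < x <= n.+1.
  by rewrite -(standard_mem _ _ _ sH) (perm_mem pK) mem_head.
have pKi : perm_eq (x :: entries K) (iota 1 n.+1).
  by rewrite perm_sym in pK; apply: perm_trans pK _; case: sH.
have /andP[xK uK] : uniq (x :: entries K) by rewrite (perm_uniq pKi) iota_uniq.
have xKc c' e : e \in flatten (tnth K c') -> e \in predC1 x.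
  by move=> /mem_entries eK; apply: contraNneq xK => <-.
have tK c' : tab (tnth K c').
  by rewrite KE; case: eqP => // _; apply: (standard_tab _ _ sH).
pose G := map_tuple (map (map (unbump x))) K.
have GE c' : tnth G c' = map (map (unbump x)) (tnth K c') by exact: tnth_map.
have GK c' : map (map (bump x)) (tnth G c') = tnth K c'.
  rewrite GE -map_comp -[RHS]map_id; apply/eq_in_map => s sK /=.
  rewrite -map_comp -[RHS]map_id; apply/eq_in_map => e es /=.
  by apply/unbumpK/(xKc c')/flattenP; exists s.
have sG : standard n G.
  split=> [c'|].
    rewrite is_ptabE GE tab_map //=; last first.
      by move=> a b /xKc ax /xKc bx; apply: ltn_unbump.
    rewrite -map_flatten map_inj_in_uniq; last first.
      by move=> a b /xKc ax /xKc bx /(congr1 (bump x)); rewrite !unbumpK.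
    rewrite KE; case: eqP => _; last exact: (standard_uniq _ _ sH).
    have := standard_uniq _ _ sH c.
    by rewrite -iT (perm_uniq (rsk_insert_perm _ _)) => /andP[].
  apply: (perm_map_inj (bump_inj x)); rewrite -entries_map.
  rewrite -(perm_cons x) perm_sym (perm_trans (perm_bump_iota n x xH)) // perm_sym.
  suff -> : map_tuple (map (map (bump x))) G = K by [].
  by apply: eq_from_tnth => c'; rewrite tnth_map GK.
exists G, (x, c); split=> //.
  apply: eq_from_tnth => c'; rewrite tnth_shapes GE shape_map KE.
  by case: eqP => [->//|/eqP/eo]; rewrite tnth_shapes.
apply: eq_from_tnth => c'; rewrite tnth_insert_step /= GK KE.
by case: eqP => [->|].
Qed.

(** Erasing [n.+1] is undone by appending it to a row of one component; the
    added square records which row of which component. *)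
Lemma delete_step_structure n H : standard n.+1 H ->
  exists c i, let G := delete_step n H in
  [/\ standard n G, tnth H c = append_at n.+1 i (tnth G c),
      tnth (shapes H) c = incr_nth (tnth (shapes G) c) i &
      forall c', c' != c -> tnth H c' = tnth G c'].
Proof.
move=> sH; have /entriesP[c nc] : n.+1 \in entries H by rewrite (standard_mem _ _ _ sH) ltnSn.
have [|i [T [tT nT eT eS]]] := tab_max _ _ (standard_tab _ _ sH c) (standard_uniq _ _ sH c) nc.
  by apply/allP => e /mem_entries; rewrite (standard_mem _ _ _ sH) => /andP[].
pose K := [tuple (if c' == c then T else tnth H c') | c' < r].
have KE c' : tnth K c' = if c' == c then T else tnth H c' by rewrite tnth_mktuple.
have pK : perm_eq (entries H) (n.+1 :: entries K).
  apply: (entries_add _ c) => [|c' /negPf cc']; rewrite KE ?eqxx ?cc' // eT.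
  exact: append_at_perm.
have pKn : perm_eq (entries K) (iota 1 n).
  rewrite -(perm_cons n.+1) (perm_trans _ (_ : perm_eq (entries H) _)) //.
    by rewrite perm_sym.
  by rewrite perm_sym (perm_trans (perm_iota_last n)) // perm_sym; case: sH.
have nK c' : n.+1 \notin flatten (tnth K c').
  apply/negP => /mem_entries; rewrite (perm_mem pKn) mem_iota.
  by rewrite add1n ltnn andbF.
have eK : delete_step n H = K.
  apply: eq_from_tnth => c'; rewrite tnth_map; have := nK c'; rewrite KE.
  case: eqP => [-> _|_]; first by rewrite eT append_atK.
  exact/remove_entry_id/(standard_tab _ _ sH).
exists c, i; rewrite eK; split; rewrite ?tnth_shapes ?KE ?eqxx //.
  split=> // c'; rewrite is_ptabE KE; case: eqP => [_|_]; last first.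
    by rewrite (standard_tab _ _ sH) (standard_uniq _ _ sH).
  have := standard_uniq _ _ sH c.
  by rewrite tT eT (perm_uniq (append_at_perm _ _ _)) => /andP[].
by move=> c' /negPf cc'; rewrite KE cc'.
Qed.

Lemma delete_step_standard n H : standard n.+1 H ->
  standard n (delete_step n H) /\ covers (shapes H) (shapes (delete_step n H)).
Proof.
case/delete_step_structure=> c [i [sG _ eS eo]]; split=> //.
by exists c, i; split=> // c' /eo; rewrite !tnth_shapes => ->.
Qed.

Lemma delete_step_inj n H1 H2 : standard n.+1 H1 -> standard n.+1 H2 ->
  shapes H1 = shapes H2 -> delete_step n H1 = delete_step n H2 -> H1 = H2.
Proof.
case/delete_step_structure=> c1 [i1 [_ eH1 eS1 eo1]].
case/delete_step_structure=> c2 [i2 [_ eH2 eS2 eo2]] eS eD.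
rewrite -eD in eH2 eS2 eo2.
have ec : c1 = c2.
  apply/eqP/negP => /negP c12; have := eS1; rewrite eS !tnth_shapes eo2 //.
  by move/esym/incr_nth_neq.
rewrite -ec in eH2 eS2 eo2.
have ei : i1 = i2.
  by apply: (@incr_nth_inj (tnth (shapes (delete_step n H1)) c1)); rewrite -eS1 eS.
apply: eq_from_tnth => c; have [->|cc] := eqVneq c c1; first by rewrite eH1 eH2 ei.
by rewrite eo1 // eo2.
Qed.

Lemma delete_step_surj n G L : standard n G -> Yr r L -> covers L (shapes G) ->
  exists H, [/\ standard n.+1 H, shapes H = L & delete_step n H = G].
Proof.
move=> sG yL [c [i [ei eo]]]; rewrite tnth_shapes in ei.
have nG c' : n.+1 \notin flatten (tnth G c').
  by apply/negP => /mem_entries; rewrite (standard_mem _ _ _ sG) ltnn andbF.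
have pL : is_part (incr_nth (tab_shape (tnth G c)) i) by rewrite -ei; apply: yL.
have [|tA eA] := append_at_tab n.+1 i _ (standard_tab _ _ sG c) _ pL.
  by apply/allP => e /mem_entries; rewrite (standard_mem _ _ _ sG) => /andP[].
pose H := [tuple (if c' == c then append_at n.+1 i (tnth G c) else tnth G c') | c' < r].
have HE c' : tnth H c' = if c' == c then append_at n.+1 i (tnth G c) else tnth G c'.
  by rewrite tnth_mktuple.
have pH : perm_eq (entries H) (n.+1 :: entries G).
  apply: (entries_add _ c) => [|c' /negPf cc']; rewrite HE ?eqxx ?cc' //.
  exact: append_at_perm.
exists H; split; first split.
- move=> c'; rewrite is_ptabE HE; case: eqP => [_|_]; last first.
    by rewrite (standard_tab _ _ sG) (standard_uniq _ _ sG).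
  by rewrite tA (perm_uniq (append_at_perm _ _ _)) /= nG (standard_uniq _ _ sG).
- apply: perm_trans pH (perm_trans _ (perm_iota_last n)).
  by rewrite perm_cons; case: sG.
- apply: eq_from_tnth => c'; rewrite tnth_shapes HE.
  by case: eqP => [->|/eqP/eo ->]; rewrite ?eA ?ei ?tnth_shapes.
apply: eq_from_tnth => c'; rewrite tnth_map HE; case: eqP => [->|_].
  by rewrite append_atK // (standard_tab _ _ sG).
by rewrite remove_entry_id // (standard_tab _ _ sG).
Qed.

End Tuples.

(** * Runs of half-steps *)

Section Runs.

Context {r : nat}.
Implicit Types (G H : r.-tuple (seq (seq nat))) (L M : r.-tuple (seq nat)).
Implicit Types (D : seq (r.-tuple (seq nat))) (w : seq (nat * 'I_r)).

Lemma VTup0 M L D : VTup 0 M L D <-> [/\ D = [:: M], L = M & Yr r M].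
Proof.
split=> [[sD [e0 e1] yD _]|[-> -> yM]].
  by case: D sD e0 e1 yD => [|N [|? ?]] //= _ -> -> /(_ 0 isT).
by split=> // j; rewrite leqn0 => /eqP ->.
Qed.

(** Decomposition of an alternating sequence at its last step; the step of
    index [m] goes down when [m] is odd. *)
Lemma VTupS m M L D : VTup m.+1 M L D <->
  exists D' L', [/\ D = rcons D' L, VTup m M L' D', Yr r L &
                    if odd m then covers L' L else covers L L'].
Proof.
split=> [[sD [e0 e1] yD cD]|[D' [L' [-> [sD [e0 e1] yD cD] yL cL]]]].
  case/lastP: D sD e0 e1 yD cD => // D N; rewrite size_rcons => -[sD].
  have nD j : j <= m -> nth M (rcons D N) j = nth M D j.
    by move=> jm; rewrite nth_rcons sD ltnS jm.
  have nN : nth M (rcons D N) m.+1 = N by rewrite nth_rcons sD ltnn eqxx.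
  rewrite nD // nN => e0 e1 yD cD; subst L; exists D, (nth M D m); split=> //.
  - split=> // j jm; first by rewrite -nD //; apply: yD; apply: leqW.
    by rewrite -!nD // ?(ltnW jm) //; apply: cD; apply: leqW.
  - by have := yD m.+1 (leqnn _); rewrite nN.
  by have := cD m (ltnSn _); rewrite nN nD.
have nD j : j <= m -> nth M (rcons D' L) j = nth M D' j.
  by move=> jm; rewrite nth_rcons sD ltnS jm.
have nN : nth M (rcons D' L) m.+1 = L by rewrite nth_rcons sD ltnn eqxx.
split; rewrite ?size_rcons ?sD ?nN ?(nD 0) //.
- move=> j; rewrite leq_eqVlt => /predU1P[->|jm]; first by rewrite nN.
  by rewrite nD //; apply: yD.
move=> j; rewrite ltnS leq_eqVlt => /predU1P[->|jm]; first by rewrite nN nD // e1.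
by rewrite !nD // ?(ltnW jm) //; apply: cD.
Qed.

Lemma VTup_last m M L D : VTup m M L D -> Yr r L /\ last M D = L.
Proof.
case: m => [/VTup0[-> -> //]|m /VTupS[D' [L' [-> _ yL _]]]].
by rewrite last_rcons.
Qed.

Lemma size_ins_del n G w : size (ins_del n G w) = (2 * size w).+1.
Proof. by elim: w G => //= a w IHw G; rewrite IHw mulnS. Qed.

Lemma ins_del_rcons n G w a : ins_del n G (rcons w a) =
  let H := insert_step (last G (ins_del n G w)) a in
  ins_del n G w ++ [:: H; delete_step n H].
Proof.
elim: w G => //= b w IHw G; rewrite IHw /=.
by case: w {IHw}.
Qed.

(** The first [m] half-steps, for [m] at most twice the length of the word. *)
Definition run n m (x : r.-tuple (seq (seq nat)) * seq (nat * 'I_r)) :=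
  let t := take m.+1 (ins_del n x.1 x.2) in (last x.1 t, map (@shapes r) t).

Lemma run_insert n m G w a : ~~ odd m -> size w = uphalf m ->
  run n m.+1 (G, rcons w a) =
  let H := insert_step (run n m (G, w)).1 a in
  (H, rcons (run n m (G, w)).2 (shapes H)).
Proof.
move=> em sw; have {}sw : size (ins_del n G w) = m.+1.
  by rewrite size_ins_del sw uphalf_half (negPf em) mul2n halfK (negPf em) subn0.
rewrite /run /= ins_del_rcons take_cat sw ltnNge leqnSn /= subSn // subnn /=.
by rewrite take_oversize ?sw // last_cat map_cat cats1.
Qed.

Lemma run_delete n m G w : odd m -> size w = uphalf m ->
  run n m.+1 (G, w) =
  let K := delete_step n (run n m (G, w)).1 in
  (K, rcons (run n m (G, w)).2 (shapes K)).
Proof.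
case/lastP: w => [|w a] om; first by case: m om.
rewrite size_rcons uphalf_half om => -[sw].
have {}sw : size (ins_del n G w) = m.
  by rewrite size_ins_del sw mul2n -add1n -[1]/(nat_of_bool true) -om odd_double_half.
rewrite /run /= ins_del_rcons !take_cat sw !ltnNge leqnSn.
rewrite (leq_trans (leqnSn m)) //= subSn // subSn // subnn /=.
by rewrite !last_cat /= !map_cat -cats1 -catA.
Qed.

Definition valid n w := all (fun a => 0 < a.1 <= n.+1) w.

(** Induction on [m]: the last half-step is a bijection given the last two
    shapes, and the last shape but one is the endpoint of the shorter sequence.
    Only an up step consumes a letter, so [m] half-steps use [uphalf m] of them. *)
Lemma run_bij n m M : Yr_rk r n M ->
  set_bij [set x | [/\ standard n x.1, shapes x.1 = M, size x.2 = uphalf m & valid n x.2]]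
          [set y | standard (n + odd m) y.1 /\ VTup m M (shapes y.1) y.2]
          (run n m).
Proof.
move=> [yM rM]; elim: m => [|m [IHf IHi IHs]].
  split.
  - move=> [G w] /= [sG eG /size0nil -> _]; rewrite addn0; split=> //.
    by apply/VTup0; rewrite /= eG.
  - move=> [G1 w1] [G2 w2]; rewrite !inE /= => -[s1 _ z1 _] [s2 _ z2 _].
    by rewrite (size0nil z1) (size0nil z2) /run /= => -[-> _].
  move=> [H D] /= []; rewrite addn0 => sH /VTup0[-> eH _].
  by exists (H, [::]); rewrite // /run /= eH.
have [om|em] := boolP (odd m).
  have -> : uphalf m.+1 = uphalf m by rewrite [RHS]uphalf_half om.
  have -> : n + odd m.+1 = n by rewrite oddS om addn0.
  have em : n + odd m = n.+1 by rewrite om addn1.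
  rewrite em in IHf IHi IHs; split.
  - move=> [G w] h; have [_ _ sw _] := h; rewrite run_delete //.
    case: (run n m (G, w)) (IHf _ h) => H D /= [sH vH].
    have [sK cK] := delete_step_standard _ _ sH.
    split=> //; apply/VTupS; exists D, (shapes H).
    by rewrite om; split=> //; apply: standard_Yr sK.
  - move=> [G1 w1] [G2 w2] m1 m2; have inj := IHi _ _ m1 m2.
    have h1 := set_mem m1; have h2 := set_mem m2.
    have [_ _ z1 _] := h1; have [_ _ z2 _] := h2; rewrite !run_delete //.
    move: (IHf _ h1) (IHf _ h2) inj.
    case: (run n m (G1, w1)) => H1 D1; case: (run n m (G2, w2)) => H2 D2 /=.
    move=> [t1 v1] [t2 v2] inj e.
    have /= eK := congr1 fst e; have /rcons_inj[eD _] := congr1 snd e.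
    have eSH : shapes H1 = shapes H2.
      have [_ <-] := VTup_last _ _ _ _ v1; have [_ <-] := VTup_last _ _ _ _ v2.
      by rewrite eD.
    by apply: inj; rewrite eD (delete_step_inj _ _ _ t1 t2 eSH eK).
  move=> [K D] [/= sK /VTupS[D' [L [-> vD yK]]]]; rewrite om => cK.
  have [yL _] := VTup_last _ _ _ _ vD.
  have [H [sH eH eK]] := delete_step_surj _ _ _ sK yL cK.
  have [|[G w] h e] := IHs (H, D'); first by rewrite /= eH.
  by exists (G, w) => //; have [_ _ sw _] := h; rewrite run_delete // e /= eK.
have -> : uphalf m.+1 = (uphalf m).+1 by rewrite [in RHS]uphalf_half (negPf em).
have -> : n + odd m.+1 = n.+1 by rewrite oddS em addn1.
have om : n + odd m = n by rewrite (negPf em) addn0.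
rewrite om in IHf IHi IHs; split.
- move=> [G w]; case/lastP: w => [[]//|w a] [sG eG z v].
  move: z v; rewrite /valid [_.2]/= size_rcons all_rcons => -[sw] /andP[va vw].
  have := IHf (G, w) (And4 sG eG sw vw); rewrite /mkset run_insert //.
  case: (run n m (G, w)) => H D /= [sH vH].
  have [sK cK] := insert_step_standard _ _ a sH va.
  split=> //; apply/VTupS; exists D, (shapes H).
  by rewrite (negPf em); split=> //; apply: standard_Yr sK.
- move=> [G1 w1] [G2 w2] /set_mem[/= s1 e1 z1 v1] /set_mem[/= s2 e2 z2 v2].
  case/lastP: w1 z1 v1 => // w1 a1; case/lastP: w2 z2 v2 => // w2 a2.
  rewrite !size_rcons /valid !all_rcons => -[z2] /andP[va2 v2] [z1] /andP[va1 v1].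
  rewrite !run_insert //.
  have h1 := And4 s1 e1 z1 v1; have h2 := And4 s2 e2 z2 v2.
  move: (IHf (G1, w1) h1) (IHf (G2, w2) h2) (IHi (G1, w1) (G2, w2) (mem_set h1) (mem_set h2)).
  case: (run n m (G1, w1)) => H1 D1; case: (run n m (G2, w2)) => H2 D2 /=.
  move=> [t1 u1] [t2 u2] inj e.
  have /= eH := congr1 fst e; have /rcons_inj[eD _] := congr1 snd e.
  have e12 : shapes H1 = shapes H2.
    have [_ <-] := VTup_last _ _ _ _ u1; have [_ <-] := VTup_last _ _ _ _ u2.
    by rewrite eD.
  have [eH12 ->] := insert_step_inj _ _ _ _ _ _ t1 t2 e12 eH.
  by rewrite eH12 eD in inj; have [-> ->] := inj erefl.
move=> [K D] [/= sK /VTupS[D' [L [-> vD yK]]]]; rewrite (negPf em) => cK.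
have [yL _] := VTup_last _ _ _ _ vD.
have [H [a [sH eH va eK]]] := insert_step_surj _ _ _ sK yL cK.
have [|[G w] h e] := IHs (H, D'); first by rewrite /= eH.
have [/= sG eG sw vw] := h.
exists (G, rcons w a); last by rewrite run_insert // e /= eK.
by split=> //=; rewrite ?size_rcons ?sw // /valid all_rcons va.
Qed.

End Runs.

Theorem mainTheorem6 (r n k : nat) (Theta : r.-tuple (seq nat))
    (hr : 1 <= r) (hTheta : Yr_rk r n Theta) :
  set_bij (EE Theta `*` words r n k)
          (\bigcup_(Lambda in Yr_rk r n)
             (EE Lambda `*` VTup (2 * k) Theta Lambda))
          (@phi r n k) /\
  (1 <= k ->
   set_bij (EE Theta `*` words r n k)
           (\bigcup_(Lambda in Yr_rk r n.+1)
              (EE Lambda `*` VTup (2 * k - 1) Theta Lambda))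
           (@phi_half r n k)).
Proof.
have rT : rk Theta = n by case: hTheta.
(* [run_bij] with words of length [k] and the target as a union over shapes. *)
have main m N (f : _ -> _) : uphalf m = k -> n + odd m = N ->
    (forall x : _ * k.-tuple _, f x = run n m (x.1, tval x.2)) ->
    set_bij (EE Theta `*` words r n k)
      (\bigcup_(Lambda in Yr_rk r N) (EE Lambda `*` VTup m Theta Lambda)) f.
  move=> um <- fE; have [Hf Hi Hs] := run_bij n m Theta hTheta.
  have dom (x : _ * k.-tuple _) : (EE Theta `*` words r n k) x <->
      [/\ standard n x.1, shapes x.1 = Theta, size (tval x.2) = uphalf m & valid n x.2].
    rewrite size_tuple um; split.
      move=> [/(EE_standard n Theta _ rT)[sG eG] vw]; split=> //.
      by apply/all_tnthP => j; apply: vw.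
    move=> [sG eG _ /all_tnthP vw]; split=> //.
    exact/(EE_standard n Theta _ rT).
  have cod y : (\bigcup_(Lambda in Yr_rk r (n + odd m))
        (EE Lambda `*` VTup m Theta Lambda)) y <->
      standard (n + odd m) y.1 /\ VTup m Theta (shapes y.1) y.2.
    split=> [[L [yL rL] [/(EE_standard _ L _ rL)[sG ->] vD]]|[sG vD]] //.
    have rS := standard_rk _ _ sG; exists (shapes y.1).
      by split=> //; apply: standard_Yr sG.
    by split=> //; apply/(EE_standard _ _ _ rS).
  split.
  - by move=> x /dom hx; apply/cod; rewrite fE; apply: (Hf (x.1, tval x.2)).
  - move=> [G1 w1] [G2 w2] /set_mem/dom h1 /set_mem/dom h2; rewrite !fE /= => e.
    have [] : (G1, tval w1) = (G2, tval w2) by apply: Hi e; rewrite inE.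
    by move=> -> /val_inj ->.
  move=> y /cod hy; have [[G w] h e] := Hs _ hy; have [/= _ _ sw _] := h.
  have {}sw : size w == k by rewrite sw um.
  exists (G, Tuple sw); last by rewrite fE.
  exact/dom.
split=> [|k1].
  apply: main => [||x]; rewrite ?mul2n ?uphalf_double ?odd_double ?addn0 //.
  by rewrite /phi /run take_oversize // size_ins_del size_tuple mul2n.
have e2 : (2 * k - 1).+1 = 2 * k by rewrite subn1 prednK // muln_gt0.
have o2 : odd (2 * k - 1).
  by rewrite -[odd _]negbK -oddS e2 mul2n odd_double.
apply: main => [||x]; rewrite ?o2 ?addn1 //.
  by rewrite -[uphalf _]/((2 * k - 1).+1./2) e2 mul2n doubleK.
by rewrite /phi_half /run e2.
Qed.
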